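(* Consider $$x^{\Delta}(t)=a(t)x(t)+b(t)x(\delta_{-}(h,t))\delta_{-}^{\Delta}(h,t),\qquad t\in[t_0,\infty)_{\mathbb{T}},\tag{E}$$ and put $Q(t):=a(t)+b(\delta_{+}(h,t))$ and $\beta(t):=t-\delta_{-}(h,t)$. Let $a\in\mathcal{R}^{+}$ and $Q\in\mathcal{R}$. Assume that there exists $\lambda>0$ such that $$-\frac{\lambda\,\delta_{-}^{\Delta}(h,t)}{\beta(t)+\lambda[\beta(t)+\mu(t)]}\le Q(t)\le-\lambda[\beta(t)+\mu(t)]\,b(\delta_{+}(h,t))^{2}-\mu(t)Q^{2}(t)$$ for all $t\in[t_0,\infty)_{\mathbb{T}}$. For a solution $x$ of (E) let $$V(t_0)=\left(x(t_0)+\int_{\delta_{-}(h,t_0)}^{t_0}b(\delta_{+}(h,s))x(s)\,\Delta s\right)^{2}+\lambda\int_{\delta_{-}(h,t_0)}^{t_0}\left(\int_{s}^{t_0}b(\delta_{+}(h,u))^{2}x(u)^{2}\,\Delta u\right)\Delta s .$$ If $(t_0,h)_{\mathbb{T}}=\varnothing$, then any solution $x(t)=x(t,t_0,\psi)$ of (E) satisfies $$|x(t)|\le\sqrt{\left(1+\frac1\lambda\right)V(t_0)}\;\exp\left(\frac12\int_{t_0}^{t}Q(s)\,\Delta s\right)$$ for all $t\in[t_0,\infty)_{\mathbb{T}}$.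
   Context: A time scale $\mathbb{T}$ is a nonempty closed subset of $\mathbb{R}$; $\sigma(t)=\inf\{s\in\mathbb{T}:s>t\}$ is the forward jump operator, $\mu(t)=\sigma(t)-t$, $f^{\Delta}$ is the delta derivative, $\int\cdot\,\Delta s$ the delta integral, and $[a,b]_{\mathbb{T}}=[a,b]\cap\mathbb{T}$ (similarly for other intervals). ''rd-continuous'' means continuous at right-dense points with finite left-sided limits at left-dense points. $\mathcal{R}$ is the set of rd-continuous functions $p$ with $1+\mu(t)p(t)\ne0$ for all $t$ (regressive), and $\mathcal{R}^{+}=\{p\in\mathcal{R}:1+\mu(t)p(t)>0\text{ for all }t\}$. Shift operators. Let $\mathbb{T}^{*}\subseteq\mathbb{T}$ be nonempty and $t_0\in\mathbb{T}^{*}$. Backward and forward shift operators $\delta_{-},\delta_{+}$ associated with the initial point $t_0$ are operators $\delta_{\pm}$ of $(s,t)\in[t_0,\infty)_{\mathbb{T}}\times\mathbb{T}^{*}$, with domains $\mathcal{D}_{\pm}=\{(s,t)\in[t_0,\infty)_{\mathbb{T}}\times\mathbb{T}^{*}:\delta_{\pm}(s,t)\in\mathbb{T}^{*}\}$ (pairs where the operator is defined with value in $\mathbb{T}^*$), satisfying: P.1: $\delta_{\pm}$ are strictly increasing in their second arguments, i.e. if $(T_0,t),(T_0,u)\in\mathcal{D}_{\pm}$, then $T_0\le t<u$ implies $\delta_{\pm}(T_0,t)<\delta_{\pm}(T_0,u)$. P.2: if $(T_1,u),(T_2,u)\in\mathcal{D}_{-}$ with $T_1<T_2$ then $\delta_{-}(T_1,u)>\delta_{-}(T_2,u)$;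 if $(T_1,u),(T_2,u)\in\mathcal{D}_{+}$ with $T_1<T_2$ then $\delta_{+}(T_1,u)<\delta_{+}(T_2,u)$. P.3: if $t\in[t_0,\infty)_{\mathbb{T}}$ then $(t,t_0)\in\mathcal{D}_{+}$ and $\delta_{+}(t,t_0)=t$; if $t\in\mathbb{T}^{*}$ then $(t_0,t)\in\mathcal{D}_{+}$ and $\delta_{+}(t_0,t)=t$. P.4: if $(s,t)\in\mathcal{D}_{\pm}$ then $(s,\delta_{\pm}(s,t))\in\mathcal{D}_{\mp}$ and $\delta_{\mp}(s,\delta_{\pm}(s,t))=t$. P.5: if $(s,t)\in\mathcal{D}_{\pm}$ and $(u,\delta_{\pm}(s,t))\in\mathcal{D}_{\mp}$ then $(s,\delta_{\mp}(u,t))\in\mathcal{D}_{\pm}$ and $\delta_{\mp}(u,\delta_{\pm}(s,t))=\delta_{\pm}(s,\delta_{\mp}(u,t))$. Delay function. $\mathbb{T}$ is unbounded above, $h\in(t_0,\infty)_{\mathbb{T}}$ is a constant such that $(h,t)\in\mathcal{D}_{\pm}$ for all $t\in[t_0,\infty)_{\mathbb{T}}$, the function $t\mapsto\delta_{-}(h,t)$ is delta differentiable with rd-continuous derivative $\delta_{-}^{\Delta}(h,t)$, is strictly increasing, and maps $[t_0,\infty)_{\mathbb{T}}$ onto $[\delta_{-}(h,t_0),\infty)_{\mathbb{T}}$; its inverse is $\delta_{+}(h,\cdot)$. Standing assumptions: $t_0\ge 0$; $a,b:\mathbb{T}\to\mathbb{R}$ are rd-continuous; $|\delta_{-}^{\Delta}(h,t)|\le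 M<\infty$ for all $t\in[t_0,\infty)_{\mathbb{T}}$. A solution $x(t)=x(t,t_0,\psi)$ of (E) satisfies (E) on $[t_0,\infty)_{\mathbb{T}}$ and $x=\psi$ on $[\delta_{-}(h,t_0),t_0]_{\mathbb{T}}$, where $\psi:[\delta_{-}(h,t_0),t_0]_{\mathbb{T}}\to\mathbb{R}$ is a given rd-continuous initial function. *)

(* Defs.v *)
From Stdlib Require Import Reals Lra.
From Coquelicot Require Import Coquelicot.
Open Scope R_scope.

(* Stdlib real numbers with Coquelicot filters.  A time scale is a set
   [T : R -> Prop]; a function on a time scale is a total function [R -> R] of
   which only the values at points of the time scale matter.  Intervals of a
   time scale are again time scales, and the calculus below is applied to them
   whenever a function is only given on such an interval. *)

Record time_scale (T : R -> Prop) : Prop := {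
  ts_nonempty : exists t, T t;
  ts_closed : closed T
}.

Definition unbounded_above (T : R -> Prop) : Prop :=
  forall m, exists t, T t /\ m < t.

Definition ts_Icc (T : R -> Prop) (a b : R) : R -> Prop :=
  fun t => T t /\ a <= t <= b.

Definition ts_Ici (T : R -> Prop) (a : R) : R -> Prop :=
  fun t => T t /\ a <= t.

(* For t in T the set of later points is empty exactly when t is the maximum of
   T, and then sigma t = t (convention inf {} = sup T); symmetrically for rho. *)
Definition sigma (T : R -> Prop) (t : R) : R :=
  match Glb_Rbar (fun s => T s /\ t < s) with
  | Finite s => s
  | _ => t
  end.

Definition rho (T : R -> Prop) (t : R) : R :=
  match Lub_Rbar (fun s => T s /\ s < t) with
  | Finite s => s
  | _ => t
  end.

Definition mu (T : R -> Prop) (t : R) : R := sigma T t - t.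

Definition right_dense (T : R -> Prop) (t : R) : Prop :=
  (exists s, T s /\ t < s) /\ sigma T t = t.

Definition left_dense (T : R -> Prop) (t : R) : Prop :=
  (exists s, T s /\ s < t) /\ rho T t = t.

Definition ts_continuous_at (T : R -> Prop) (f : R -> R) (t : R) : Prop :=
  filterlim f (within T (locally t)) (locally (f t)).

Definition rd_continuous (T : R -> Prop) (f : R -> R) : Prop :=
  forall t, T t ->
    (right_dense T t -> ts_continuous_at T f t) /\
    (left_dense T t ->
      exists l : R,
        filterlim f (within (fun s => T s /\ s < t) (locally t)) (locally l)).

Definition regressive (T : R -> Prop) (p : R -> R) : Prop :=
  rd_continuous T p /\ forall t, T t -> 1 + mu T t * p t <> 0.

Definition positively_regressive (T : R -> Prop) (p : R -> R) : Prop :=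
  regressive T p /\ forall t, T t -> 0 < 1 + mu T t * p t.

Definition is_delta_derive (T : R -> Prop) (f : R -> R) (t l : R) : Prop :=
  forall eps : posreal,
    within T (locally t) (fun s =>
      Rabs (f (sigma T t) - f s - l * (sigma T t - s))
        <= eps * Rabs (sigma T t - s)).

Definition ex_delta_derive (T : R -> Prop) (f : R -> R) (t : R) : Prop :=
  exists l, is_delta_derive T f t l.

Definition delta_derive (T : R -> Prop) (f : R -> R) (t : R) : R :=
  iota (is_delta_derive T f t).

(* Cauchy delta integral, through an antiderivative on the time scale [a,b]_T.
   The equation F^Delta = f is not imposed at the right end point, where an
   rd-continuous f may differ from its left limit; continuity of F there keeps
   the value unique.  Rmin and Rmax give the usual sign when b < a. *)
Definition is_delta_int (T : R -> Prop) (f : R -> R) (a b v : R) : Prop :=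
  exists F : R -> R,
    (forall t, ts_Icc T (Rmin a b) (Rmax a b) t ->
       ts_continuous_at (ts_Icc T (Rmin a b) (Rmax a b)) F t) /\
    (forall t, ts_Icc T (Rmin a b) (Rmax a b) t -> t < Rmax a b ->
       is_delta_derive (ts_Icc T (Rmin a b) (Rmax a b)) F t (f t)) /\
    v = F b - F a.

Definition delta_int (T : R -> Prop) (f : R -> R) (a b : R) : R :=
  iota (is_delta_int T f a b).

(* A partial binary operation: the value [pop d s t] is meaningful only when
   [pop_defined d s t] holds. *)
Record partial_op : Type := {
  pop :> R -> R -> R;
  pop_defined : R -> R -> Prop
}.

Definition shift_dom (T Tstar : R -> Prop) (t0 : R) (d : partial_op) (s t : R)
  : Prop :=
  ts_Ici T t0 s /\ Tstar t /\ pop_defined d s t /\ Tstar (d s t).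

Definition shift_incr_snd (T Tstar : R -> Prop) (t0 : R) (d : partial_op)
  : Prop :=
  forall T0 t u,
    shift_dom T Tstar t0 d T0 t -> shift_dom T Tstar t0 d T0 u ->
    T0 <= t -> t < u -> d T0 t < d T0 u.

Definition shift_cancel (T Tstar : R -> Prop) (t0 : R) (d d' : partial_op)
  : Prop :=
  forall s t,
    shift_dom T Tstar t0 d s t ->
    shift_dom T Tstar t0 d' s (d s t) /\ d' s (d s t) = t.

Definition shift_commute (T Tstar : R -> Prop) (t0 : R) (d d' : partial_op)
  : Prop :=
  forall s t u,
    shift_dom T Tstar t0 d s t -> shift_dom T Tstar t0 d' u (d s t) ->
    shift_dom T Tstar t0 d s (d' u t) /\ d' u (d s t) = d s (d' u t).

Record shift_operators (T Tstar : R -> Prop) (t0 : R) (dm dp : partial_op)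
  : Prop := {
  shift_sub : forall t, Tstar t -> T t;
  shift_init : Tstar t0;
  shift_P1m : shift_incr_snd T Tstar t0 dm;
  shift_P1p : shift_incr_snd T Tstar t0 dp;
  shift_P2m : forall T1 T2 u,
    shift_dom T Tstar t0 dm T1 u -> shift_dom T Tstar t0 dm T2 u ->
    T1 < T2 -> dm T1 u > dm T2 u;
  shift_P2p : forall T1 T2 u,
    shift_dom T Tstar t0 dp T1 u -> shift_dom T Tstar t0 dp T2 u ->
    T1 < T2 -> dp T1 u < dp T2 u;
  shift_P3l : forall t, ts_Ici T t0 t ->
    shift_dom T Tstar t0 dp t t0 /\ dp t t0 = t;
  shift_P3r : forall t, Tstar t ->
    shift_dom T Tstar t0 dp t0 t /\ dp t0 t = t;
  shift_P4m : shift_cancel T Tstar t0 dm dp;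
  shift_P4p : shift_cancel T Tstar t0 dp dm;
  shift_P5m : shift_commute T Tstar t0 dm dp;
  shift_P5p : shift_commute T Tstar t0 dp dm
}.

(* [dm h] is a function on the time scale [t0,oo)_T, and its delta derivative
   is taken there. *)
Record delay_function (T Tstar : R -> Prop) (t0 : R) (dm dp : partial_op)
  (h : R) : Prop := {
  delay_mem : T h;
  delay_gt : t0 < h;
  delay_domm : forall t, ts_Ici T t0 t -> shift_dom T Tstar t0 dm h t;
  delay_domp : forall t, ts_Ici T t0 t -> shift_dom T Tstar t0 dp h t;
  delay_derive : forall t, ts_Ici T t0 t ->
    ex_delta_derive (ts_Ici T t0) (dm h) t;
  delay_derive_rd :
    rd_continuous (ts_Ici T t0) (delta_derive (ts_Ici T t0) (dm h));
  delay_incr : forall t u, ts_Ici T t0 t -> ts_Ici T t0 u ->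
    t < u -> dm h t < dm h u;
  delay_onto : forall s, ts_Ici T (dm h t0) s ->
    exists t, ts_Ici T t0 t /\ dm h t = s;
  delay_inv : forall t, ts_Ici T t0 t -> dp h (dm h t) = t
}.

Record is_solution (T : R -> Prop) (t0 : R) (dm : partial_op) (h : R)
  (a b psi x : R -> R) : Prop := {
  solution_eq : forall t, ts_Ici T t0 t ->
    is_delta_derive (ts_Ici T t0) x t
      (a t * x t + b t * x (dm h t) * delta_derive (ts_Ici T t0) (dm h) t);
  solution_init : forall t, ts_Icc T (dm h t0) t0 t -> x t = psi t
}.

Definition Qfun (dp : partial_op) (h : R) (a b : R -> R) (t : R) : R :=
  a t + b (dp h t).

Definition beta (dm : partial_op) (h t : R) : R := t - dm h t.

Definition Vfun (T : R -> Prop) (dm dp : partial_op) (h lambda : R)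
  (b x : R -> R) (t : R) : R :=
  (x t + delta_int T (fun s => b (dp h s) * x s) (dm h t) t) ^ 2
  + lambda *
    delta_int T
      (fun s => delta_int T (fun u => b (dp h u) ^ 2 * x u ^ 2) s t)
      (dm h t) t.

(* Main.v *)
(* The empty gap makes [h] the successor of [t0], and [delta_+(h,.)] transports
   this gap along the time scale without fixing any point, so [t0,oo)_T is the
   orbit of [t0] under [delta_+(h,.)] and [delta_-(h,.)] is the predecessor
   map.  Hence (E) is a two-term recursion and, with [y = beta(t) b(t)
   x(delta_-(h,t))], the Lyapunov function is [(x + y)^2 + lambda y^2].  The
   upper bound on [Q] controls the [x^2] terms and the lower bound the [y^2]
   terms of [V(sigma t) <= (1 + mu Q) V(t)]; conclude by [1 + z <= exp z] and
   [x^2 <= (1 + 1/lambda) V]. *)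

Require Import Defs.
From Stdlib Require Import Reals Lra Lia.
From Coquelicot Require Import Coquelicot.
Open Scope R_scope.

(** * Delta calculus at right-scattered and isolated points *)

Definition consecutive (T : R -> Prop) (s t : R) : Prop :=
  T s /\ T t /\ s < t /\ forall u, T u -> ~ (s < u < t).

Lemma consecutive_subset (S T : R -> Prop) (s t : R) :
  (forall u, S u -> T u) -> S s -> S t -> consecutive T s t ->
  consecutive S s t.
Proof.
intros HST Hs Ht [_ [_ [Hlt Hgap]]].
split; [exact Hs | split; [exact Ht | split; [exact Hlt |]]].
intros u Hu; apply Hgap, HST, Hu.
Qed.

Lemma consecutive_sigma (T : R -> Prop) (s t : R) :
  consecutive T s t -> Defs.sigma T s = t.
Proof.
intros [Hs [Ht [Hlt Hgap]]]; unfold Defs.sigma.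
rewrite (is_glb_Rbar_unique _ (Finite t)); [reflexivity |].
split.
- intros u [Hu Hsu]; simpl.
  destruct (Rle_lt_dec t u) as [H | H]; [exact H |].
  exfalso; exact (Hgap u Hu (conj Hsu H)).
- intros l Hl; exact (Hl t (conj Ht Hlt)).
Qed.

(** The defining inequality may be tested at [s] itself, since a property that holds near [s] holds
    at [s]. A nonzero error would then be at most half of itself, by the choice of [eps] as the
    error over [2 * (t - s)]. *)
Lemma is_delta_derive_consecutive (T : R -> Prop) (f : R -> R) (s t l : R) :
  consecutive T s t -> is_delta_derive T f s l -> f t = f s + l * (t - s).
Proof.
intros Hc Hd.
assert (Hlt : s < t) by apply Hc.
unfold is_delta_derive in Hd; rewrite (consecutive_sigma _ _ _ Hc) in Hd.
destruct (Req_dec (f t - f s - l * (t - s)) 0) as [H | H]; [lra | exfalso].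
assert (Hp : 0 < Rabs (f t - f s - l * (t - s))) by now apply Rabs_pos_lt.
assert (He : 0 < Rabs (f t - f s - l * (t - s)) / (2 * (t - s)))
  by (apply Rdiv_lt_0_compat; lra).
specialize (Hd (mkposreal _ He)).
apply locally_singleton in Hd.
specialize (Hd (proj1 Hc)); simpl in Hd.
rewrite (Rabs_pos_eq (t - s)) in Hd by lra.
replace (Rabs (f t - f s - l * (t - s)) / (2 * (t - s)) * (t - s))
  with (Rabs (f t - f s - l * (t - s)) / 2) in Hd by (field; lra).
lra.
Qed.

Lemma delta_derive_consecutive (T : R -> Prop) (f : R -> R) (s t : R) :
  consecutive T s t -> ex_delta_derive T f s ->
  delta_derive T f s = (f t - f s) / (t - s).
Proof.
intros Hc [l Hl].
assert (Hlt : s < t) by apply Hc.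
assert (Hval : forall k, is_delta_derive T f s k -> k = (f t - f s) / (t - s)).
{ intros k Hk; rewrite (is_delta_derive_consecutive _ _ _ _ _ Hc Hk).
  field; lra. }
unfold delta_derive; rewrite <- (Hval l Hl).
apply (@iota_unique _ R_CompleteNormedModule); [| exact Hl].
intros k Hk; rewrite (Hval k Hk), (Hval l Hl); reflexivity.
Qed.

Definition isolated (T : R -> Prop) (t : R) : Prop :=
  locally t (fun s => T s -> s = t).

Lemma isolated_continuous (T : R -> Prop) (f : R -> R) (t : R) :
  isolated T t -> ts_continuous_at T f t.
Proof.
intros Hi P HP.
unfold filtermap, within.
apply filter_imp with (2 := Hi); intros s Hs HTs.
rewrite (Hs HTs); now apply locally_singleton.
Qed.

Lemma isolated_delta_derive (T : R -> Prop) (f : R -> R) (s t l : R) :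
  isolated T s -> consecutive T s t -> f t = f s + l * (t - s) ->
  is_delta_derive T f s l.
Proof.
intros Hi Hc Hf eps.
rewrite (consecutive_sigma _ _ _ Hc).
apply filter_imp with (2 := Hi); intros u Hu HTu.
rewrite (Hu HTu).
replace (f t - f s - l * (t - s)) with 0 by lra.
rewrite Rabs_R0; apply Rmult_le_pos; [apply Rlt_le, cond_pos | apply Rabs_pos].
Qed.

(** * Delta integrals over finite chains of consecutive points *)

Section Chain.

Variables (T : R -> Prop) (v : nat -> R) (n : nat).
Hypothesis Hv : forall k, (k < n)%nat -> consecutive T (v k) (v (S k)).

Lemma chain_lt (i j : nat) : (i < j)%nat -> (j <= n)%nat -> v i < v j.
Proof.
intros Hij Hj; induction Hij as [| j Hij IH].
- apply (Hv i); lia.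
- apply Rlt_trans with (v j); [apply IH; lia | apply (Hv j); lia].
Qed.

Lemma chain_le (i j : nat) : (i <= j)%nat -> (j <= n)%nat -> v i <= v j.
Proof.
intros Hij Hj; destruct (Nat.eq_dec i j) as [-> | H]; [lra |].
apply Rlt_le, chain_lt; lia.
Qed.

Lemma chain_points (t : R) : ts_Icc T (v 0%nat) (v n) t ->
  exists k, (k <= n)%nat /\ t = v k.
Proof.
intros [HTt [H0 Hn]].
assert (H : forall m, (m <= n)%nat ->
  (exists k, (k <= m)%nat /\ t = v k) \/ v m < t).
{ induction m as [| m IH]; intros Hm.
  - destruct (Req_dec t (v 0%nat)) as [H | H]; [left; exists 0%nat; auto | right; lra].
  - destruct IH as [[k [Hk E]] | IH]; [lia | left; exists k; split; [lia | exact E] |].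
    destruct (Req_dec t (v (S m))) as [H | H]; [left; exists (S m); auto |].
    destruct (Rlt_le_dec (v (S m)) t) as [H' | H']; [now right | exfalso].
    apply (proj2 (proj2 (proj2 (Hv m Hm))) t HTt); lra. }
destruct (H n (le_n n)) as [E | E]; [exact E | lra].
Qed.

(** The neighbours of [v k] in the chain bound an open interval without other points of the time
    scale; at either end of the chain the interval bound replaces the missing neighbour. *)
Lemma chain_isolated (k : nat) : (k <= n)%nat ->
  isolated (ts_Icc T (v 0%nat) (v n)) (v k).
Proof.
intros Hk.
set (S := ts_Icc T (v 0%nat) (v n)).
assert (Hl : locally (v k) (fun s => S s -> v k <= s)).
{ destruct k as [| k].
  - apply filter_forall; intros s Hs; apply Hs.
  - apply filter_imp with (2 := open_gt _ _ (chain_lt k (Datatypes.S k) ltac:(lia) Hk)).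
    intros s Hs HS; destruct (Rle_lt_dec (v (Datatypes.S k)) s) as [H | H]; [exact H |].
    exfalso; apply (proj2 (proj2 (proj2 (Hv k Hk))) s (proj1 HS)); lra. }
assert (Hr : locally (v k) (fun s => S s -> s <= v k)).
{ destruct (Nat.eq_dec k n) as [-> | Hn].
  - apply filter_forall; intros s Hs; apply Hs.
  - assert (Hkn : (k < n)%nat) by lia.
    apply filter_imp with (2 := open_lt _ _ (chain_lt k (Datatypes.S k) ltac:(lia) Hkn)).
    intros s Hs HS; destruct (Rle_lt_dec s (v k)) as [H | H]; [exact H |].
    exfalso; apply (proj2 (proj2 (proj2 (Hv k Hkn))) s (proj1 HS)); lra. }
apply filter_imp with (2 := filter_and _ _ Hl Hr).
intros s [H1 H2] Hs; apply Rle_antisym; auto.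
Qed.

(** Turns a sequence of values into a candidate antiderivative on the reals. It is consistent
    because strict increase makes [v] injective. *)
Lemma chain_function (G : nat -> R) :
  exists F : R -> R, forall k, (k <= n)%nat -> F (v k) = G k.
Proof.
assert (H : forall m, (m <= n)%nat ->
  exists F : R -> R, forall k, (k <= m)%nat -> F (v k) = G k).
{ induction m as [| m IH]; intros Hm.
  - exists (fun _ => G 0%nat); intros k Hk; now replace k with 0%nat by lia.
  - destruct IH as [F HF]; [lia |].
    exists (fun s => if Rlt_dec s (v (S m)) then F s else G (S m)).
    intros k Hk; destruct (Rlt_dec (v k) (v (S m))) as [H | H].
    + apply HF; destruct (Nat.eq_dec k (S m)) as [-> | Hne]; [lra | lia].
    + destruct (Nat.eq_dec k (S m)) as [-> | Hne]; [reflexivity |].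
      exfalso; apply H, chain_lt; lia. }
exact (H n (le_n n)).
Qed.

(** [G] collects the partial sums of the integral. Any antiderivative has the increments of [G],
    which gives uniqueness for [iota]; conversely, isolated points put no constraint beyond these
    increments, so [G] extends to an antiderivative. *)
Lemma delta_int_chain (f : R -> R) (G : nat -> R) :
  (forall k, (k < n)%nat -> G (S k) = G k + f (v k) * (v (S k) - v k)) ->
  delta_int T f (v 0%nat) (v n) = G n - G 0%nat.
Proof.
intros HG.
assert (H0n : v 0%nat <= v n) by (apply chain_le; lia).
assert (Hcons : forall k, (k < n)%nat ->
  consecutive (ts_Icc T (v 0%nat) (v n)) (v k) (v (S k))).
{ intros k Hk; apply consecutive_subset with T.
  - intros u Hu; apply Hu.
  - split; [apply (Hv k Hk) | split; apply chain_le; lia].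
  - split; [apply (Hv k Hk) | split; apply chain_le; lia].
  - exact (Hv k Hk). }
unfold delta_int; apply (@iota_unique _ R_CompleteNormedModule).
- intros y [F [_ [HF ->]]].
  rewrite Rmin_left, Rmax_right in HF by exact H0n.
  assert (H : forall m, (m <= n)%nat -> F (v m) - F (v 0%nat) = G m - G 0%nat).
  { induction m as [| m IH]; intros Hm; [lra |].
    rewrite (HG m Hm).
    rewrite (is_delta_derive_consecutive _ _ _ _ _ (Hcons m Hm)
               (HF _ (proj1 (Hcons m Hm)) (chain_lt m n Hm (le_n n)))).
    specialize (IH ltac:(lia)); lra. }
  exact (H n (le_n n)).
- destruct (chain_function G) as [F HF]; exists F.
  rewrite Rmin_left, Rmax_right by exact H0n.
  split; [| split].
  + intros t Ht; destruct (chain_points t Ht) as [k [Hk ->]].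
    apply isolated_continuous, chain_isolated, Hk.
  + intros t Ht Hlt; destruct (chain_points t Ht) as [k [Hk ->]].
    assert (Hkn : (k < n)%nat).
    { destruct (Nat.eq_dec k n) as [-> | H]; [lra | lia]. }
    apply isolated_delta_derive with (v (S k)).
    * apply chain_isolated, Hk.
    * exact (Hcons k Hkn).
    * rewrite !HF by lia; exact (HG k Hkn).
  + rewrite !HF by lia; reflexivity.
Qed.

End Chain.

Lemma delta_int_consecutive (T : R -> Prop) (f : R -> R) (s t : R) :
  consecutive T s t -> delta_int T f s t = f s * (t - s).
Proof.
intros Hc.
pose (v := fun k : nat => match k with 0%nat => s | _ => t end).
pose (G := fun k : nat => match k with 0%nat => 0 | _ => f s * (t - s) end).
change (delta_int T f (v 0%nat) (v 1%nat) = f s * (t - s)).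
rewrite (delta_int_chain T v 1) with (G := G).
- simpl; ring.
- intros k Hk; replace k with 0%nat by lia; exact Hc.
- intros k Hk; replace k with 0%nat by lia; simpl; ring.
Qed.

(** * The half-line from [t0] as the orbit of [t0] under [dp h] *)

Section Orbit.

Variables (T Tstar : R -> Prop) (t0 h : R) (dm dp : partial_op).
Hypothesis HT : time_scale T.
Hypothesis Hshift : shift_operators T Tstar t0 dm dp.
Hypothesis Hdelay : delay_function T Tstar t0 dm dp h.
Hypothesis Hgap : forall t, T t -> ~ (t0 < t < h).

Fixpoint orbit (n : nat) : R :=
  match n with 0%nat => t0 | S m => dp h (orbit m) end.

Lemma init_mem : ts_Ici T t0 t0.
Proof.
split; [apply (shift_sub _ _ _ _ _ Hshift), (shift_init _ _ _ _ _ Hshift) | lra].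
Qed.

Lemma delay_point_mem : ts_Ici T t0 h.
Proof.
split; [apply (delay_mem _ _ _ _ _ _ Hdelay) |].
apply Rlt_le, (delay_gt _ _ _ _ _ _ Hdelay).
Qed.

(** By P.3 the shift by [t0] is the identity, and by P.2 the shift by the larger [h] goes strictly
    further. *)
Lemma dp_gt (t : R) : ts_Ici T t0 t -> t < dp h t.
Proof.
intros Ht.
assert (Hd := delay_domp _ _ _ _ _ _ Hdelay t Ht).
destruct (shift_P3r _ _ _ _ _ Hshift t (proj1 (proj2 Hd))) as [H1 H2].
rewrite <- H2 at 1.
exact (shift_P2p _ _ _ _ _ Hshift _ _ _ H1 Hd (delay_gt _ _ _ _ _ _ Hdelay)).
Qed.

Lemma dm_dp (t : R) : ts_Ici T t0 t -> dm h (dp h t) = t.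
Proof.
intros Ht.
apply (shift_P4p _ _ _ _ _ Hshift), (delay_domp _ _ _ _ _ _ Hdelay _ Ht).
Qed.

Lemma dp_mem (t : R) : ts_Ici T t0 t -> ts_Ici T t0 (dp h t).
Proof.
intros Ht; split.
- apply (shift_sub _ _ _ _ _ Hshift), (delay_domp _ _ _ _ _ _ Hdelay _ Ht).
- apply Rle_trans with t; [apply Ht | apply Rlt_le, dp_gt, Ht].
Qed.

Lemma dm_T (t : R) : ts_Ici T t0 t -> T (dm h t).
Proof.
intros Ht.
apply (shift_sub _ _ _ _ _ Hshift), (delay_domm _ _ _ _ _ _ Hdelay _ Ht).
Qed.

Lemma dm_le (t u : R) : ts_Ici T t0 t -> ts_Ici T t0 u -> t <= u ->
  dm h t <= dm h u.
Proof.
intros Ht Hu [H | ->]; [| lra].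
apply Rlt_le, (delay_incr _ _ _ _ _ _ Hdelay); assumption.
Qed.

Lemma dp_init : dp h t0 = h.
Proof. apply (shift_P3l _ _ _ _ _ Hshift), delay_point_mem. Qed.

Lemma dm_delay_point : dm h h = t0.
Proof. rewrite <- dp_init at 2; apply dm_dp, init_mem. Qed.

Lemma orbit_mem (n : nat) : ts_Ici T t0 (orbit n).
Proof. induction n as [| n IH]; [exact init_mem | exact (dp_mem _ IH)]. Qed.

(** A point inside one gap would be pulled back by [dm h] into the previous gap, and so down to the
    empty gap between [t0] and [h]. *)
Lemma orbit_consecutive (n : nat) : consecutive T (orbit n) (orbit (S n)).
Proof.
split; [apply orbit_mem | split; [apply orbit_mem | split; [apply dp_gt, orbit_mem |]]].
induction n as [| n IH]; intros u Hu Hlt.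
- simpl in Hlt; rewrite dp_init in Hlt; exact (Hgap u Hu Hlt).
- assert (Hui : ts_Ici T t0 u).
  { split; [exact Hu |].
    assert (H := proj2 (orbit_mem (S n))); lra. }
  apply (IH (dm h u) (dm_T _ Hui)).
  rewrite <- (dm_dp (orbit n)) by apply orbit_mem.
  rewrite <- (dm_dp (orbit (S n))) by apply orbit_mem.
  split; apply (delay_incr _ _ _ _ _ _ Hdelay); try apply Hlt; try exact Hui;
    [apply (orbit_mem (S n)) | apply (orbit_mem (S (S n)))].
Qed.

(** Only the point before [t0] is new: by surjectivity of the delay, a point between [dm h t0] and
    [t0 = dm h h] is [dm h t] for some [t], and monotonicity places [t] in the empty gap. *)
Lemma dm_orbit_consecutive (n : nat) : consecutive T (dm h (orbit n)) (orbit n).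
Proof.
destruct n as [| n].
- assert (Hinc : dm h t0 < dm h h).
  { apply (delay_incr _ _ _ _ _ _ Hdelay);
      [exact init_mem | exact delay_point_mem | apply (delay_gt _ _ _ _ _ _ Hdelay)]. }
  assert (Hh := dm_delay_point); simpl.
  split; [apply dm_T, init_mem | split; [apply init_mem | split; [lra |]]].
  intros s Hs Hlt.
  destruct (delay_onto _ _ _ _ _ _ Hdelay s) as [t [Ht E]]; [split; [exact Hs | lra] |].
  subst s; apply (Hgap t (proj1 Ht)); split.
  + destruct (Rle_lt_dec t t0) as [H | H]; [| exact H].
    assert (H' := dm_le _ _ Ht init_mem H); lra.
  + destruct (Rle_lt_dec h t) as [H | H]; [| exact H].
    assert (H' := dm_le _ _ delay_point_mem Ht H); lra.
- simpl; rewrite dm_dp by apply orbit_mem; exact (orbit_consecutive n).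
Qed.

(* An accumulation point [l] of the orbit would satisfy [dm h l = l], whereas
   P.2 and P.3 force [dp h] to move every point. *)
Lemma orbit_onto (t : R) : ts_Ici T t0 t -> exists n, t = orbit n.
Proof.
intros Ht.
destruct (Classical_Prop.classic (exists n, t = orbit n)) as [H | Hno]; [exact H | exfalso].
assert (Hlt : forall n, orbit n < t).
{ induction n as [| n IH].
  - destruct (proj2 Ht) as [H | H]; [exact H |].
    exfalso; apply Hno; exists 0%nat; now symmetry.
  - destruct (Rtotal_order (orbit (S n)) t) as [H | [H | H]]; [exact H | |].
    + exfalso; apply Hno; exists (S n); now symmetry.
    + exfalso; exact (proj2 (proj2 (proj2 (orbit_consecutive n))) t (proj1 Ht) (conj IH H)). }
destruct (completeness (fun r => exists n, r = orbit n)) as [l [Hub Hlub]].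
{ exists t; intros r [n ->]; apply Rlt_le, Hlt. }
{ exists t0, 0%nat; reflexivity. }
assert (Hle : forall n, orbit n <= l) by (intros n; apply Hub; now exists n).
assert (Happ : forall r, r < l -> exists n, r < orbit n).
{ intros r Hr; apply Classical_Prop.NNPP; intros Hn.
  apply (Rlt_not_le _ _ Hr), Hlub; intros s [n ->].
  destruct (Rle_lt_dec (orbit n) r) as [H | H]; [exact H | exfalso; eauto]. }
assert (Hl : ts_Ici T t0 l).
{ split; [| apply (Hle 0%nat)].
  apply (ts_closed _ HT); intros [eps He].
  destruct (Happ (l - eps)) as [n Hn]; [assert (H := cond_pos eps); lra |].
  apply (He (orbit n)); [| apply orbit_mem].
  assert (H := Hle n).
  change (Rabs (orbit n - l) < eps); apply Rabs_def1; [assert (H' := cond_pos eps) |]; lra. }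
assert (Hhl : h <= l) by (rewrite <- dp_init; exact (Hle 1%nat)).
assert (Hm : ts_Ici T t0 (dm h l)).
{ split; [exact (dm_T _ Hl) |].
  rewrite <- dm_delay_point; exact (dm_le _ _ delay_point_mem Hl Hhl). }
(* As [dp h] moves [dm h l] up to [l], some orbit point exceeds [dm h l]. But its successor is at
   most [l], so applying [dm h] puts the point itself at or below [dm h l]. *)
assert (Hml := dp_gt _ Hm).
rewrite (delay_inv _ _ _ _ _ _ Hdelay _ Hl) in Hml.
destruct (Happ _ Hml) as [n Hn].
assert (H := dm_le _ _ (orbit_mem (S n)) Hl (Hle (S n))).
simpl in H; rewrite dm_dp in H by apply orbit_mem; lra.
Qed.

End Orbit.

(** * Quadratic inequalities for the Lyapunov function *)

(* [p], [m] are the graininess before and after the current point, [b] the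
   coefficient at the next point and [y = p * b(t) * x(dm h t)]. *)
Lemma lyapunov_step (lambda p m q b x y : R) :
  0 < lambda -> 0 < p -> 0 < m ->
  - (lambda * (p / m) / (p + lambda * (p + m))) <= q ->
  q <= - lambda * (p + m) * b ^ 2 - m * q ^ 2 ->
  (x + y + q * x * m) ^ 2 + lambda * (m * b * x) ^ 2
  <= (1 + q * m) * ((x + y) ^ 2 + lambda * y ^ 2).
Proof.
intros Hl Hp Hm Hlow Hup.
assert (Hlp := Rmult_lt_0_compat _ _ Hl Hp).
assert (Hlm := Rmult_lt_0_compat _ _ Hl Hm).
assert (Hd : 0 < p + lambda * (p + m)) by lra.
(* In right side minus left side the [x * y] terms cancel. [H1] is the sign of the coefficient of
   [y ^ 2]; [H2], multiplied by [- m], is that of [x ^ 2]. *)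
assert (H1 : 0 <= q * m * (1 + lambda) + lambda).
{ assert (H : - (lambda * p / (p + lambda * (p + m))) <= q * m).
  { replace (- (lambda * p / (p + lambda * (p + m))))
      with (- (lambda * (p / m) / (p + lambda * (p + m))) * m) by (field; lra).
    apply Rmult_le_compat_r; lra. }
  (* Dropping [lambda * m] from the denominator leaves [(1 + lambda) * p]. *)
  assert (H' : lambda * p / (p + lambda * (p + m)) <= lambda / (1 + lambda)).
  { apply Rle_div_l; [exact Hd |].
    replace (lambda / (1 + lambda) * (p + lambda * (p + m)))
      with (lambda * p + lambda * (lambda * m) / (1 + lambda)) by (field; lra).
    assert (0 <= lambda * (lambda * m) / (1 + lambda)); [| lra].
    apply Rlt_le, Rdiv_lt_0_compat; [apply Rmult_lt_0_compat |]; lra. }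
  assert (H2 : - (lambda / (1 + lambda)) * (1 + lambda) <= q * m * (1 + lambda))
    by (apply Rmult_le_compat_r; lra).
  replace (- (lambda / (1 + lambda)) * (1 + lambda)) with (- lambda) in H2
    by (field; lra).
  lra. }
assert (H2 : q + m * q ^ 2 + lambda * m * b ^ 2 <= 0).
{ assert (H := Rmult_le_pos _ _ (Rlt_le _ _ Hlp) (pow2_ge_0 b)); lra. }
assert (H3 := Rmult_le_pos _ _ H1 (pow2_ge_0 y)).
assert (H4 : 0 <= m * - (q + m * q ^ 2 + lambda * m * b ^ 2) * x ^ 2).
{ apply Rmult_le_pos; [apply Rmult_le_pos; lra | apply pow2_ge_0]. }
lra.
Qed.

(** Completing the square in [y]: the right side attains its minimum [x ^ 2] at
    [(1 + lambda) * y = - x], which is where the constant [1 + 1 / lambda] comes from. *)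
Lemma lyapunov_lower (lambda x y : R) :
  0 < lambda -> x ^ 2 <= (1 + 1 / lambda) * ((x + y) ^ 2 + lambda * y ^ 2).
Proof.
intros Hl.
replace ((1 + 1 / lambda) * ((x + y) ^ 2 + lambda * y ^ 2))
  with (x ^ 2 + (x + (1 + lambda) * y) ^ 2 / lambda) by (field; lra).
assert (H : 0 <= (x + (1 + lambda) * y) ^ 2 / lambda); [| lra].
apply Rdiv_le_0_compat; [apply pow2_ge_0 | exact Hl].
Qed.

(** * Growth of the Lyapunov function along the orbit *)

Theorem theorem5
  (T Tstar : R -> Prop) (t0 h : R) (dm dp : partial_op)
  (a b : R -> R) (M lambda : R) (psi x : R -> R)
  (HT : time_scale T)
  (HTinf : unbounded_above T)
  (Hshift : shift_operators T Tstar t0 dm dp)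
  (Hdelay : delay_function T Tstar t0 dm dp h)
  (Ht0 : 0 <= t0)
  (Ha : rd_continuous T a)
  (Hb : rd_continuous T b)
  (HM : forall t, ts_Ici T t0 t ->
     Rabs (delta_derive (ts_Ici T t0) (dm h) t) <= M)
  (HaR : positively_regressive T a)
  (HQR : regressive (ts_Ici T t0) (Qfun dp h a b))
  (Hlambda : 0 < lambda)
  (HQlow : forall t, ts_Ici T t0 t ->
     - (lambda * delta_derive (ts_Ici T t0) (dm h) t
        / (beta dm h t + lambda * (beta dm h t + mu T t)))
     <= Qfun dp h a b t)
  (HQup : forall t, ts_Ici T t0 t ->
     Qfun dp h a b t
     <= - lambda * (beta dm h t + mu T t) * b (dp h t) ^ 2
        - mu T t * Qfun dp h a b t ^ 2)
  (Hgap : forall t, T t -> ~ (t0 < t < h))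
  (Hpsi : rd_continuous (ts_Icc T (dm h t0) t0) psi)
  (Hx : is_solution T t0 dm h a b psi x) :
  forall t, ts_Ici T t0 t ->
    Rabs (x t)
    <= sqrt ((1 + 1 / lambda) * Vfun T dm dp h lambda b x t0)
       * exp (1 / 2 * delta_int T (Qfun dp h a b) t0 t).
Proof.
intros t Ht.
assert (Horb := orbit_mem _ _ _ _ _ _ Hshift Hdelay).
assert (Hcon := orbit_consecutive _ _ _ _ _ _ Hshift Hdelay Hgap).
assert (Hpre := dm_orbit_consecutive _ _ _ _ _ _ Hshift Hdelay Hgap).
assert (Hdmdp := dm_dp _ _ _ _ _ _ Hshift Hdelay).
destruct (orbit_onto _ _ _ _ _ _ HT Hshift Hdelay Hgap t Ht) as [n ->].
assert (Hdpdm := delay_inv _ _ _ _ _ _ Hdelay).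
set (u := orbit t0 h dp) in *.
set (Q := Qfun dp h a b) in *.
pose (y := fun k => (u k - dm h (u k)) * b (u k) * x (dm h (u k))).
pose (V := fun k => (x (u k) + y k) ^ 2 + lambda * y k ^ 2).
pose (G := fix G k := match k with
                      | 0%nat => 0
                      | S j => G j + Q (u j) * (u (S j) - u j)
                      end).
assert (HV0 : Vfun T dm dp h lambda b x t0 = V 0%nat).
{ unfold Vfun, V, y; change (u 0%nat) with t0.
  (* Each integral runs over a single gap, so it is the gap length times the value at the left end;
     the double integral thereby collapses to [y 0 ^ 2]. *)
  rewrite !(delta_int_consecutive _ _ _ _ (Hpre 0%nat)).
  change (u 0%nat) with t0; rewrite (Hdpdm t0 (Horb 0%nat)); ring. }
assert (HG : delta_int T Q t0 (u n) = G n).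
{ change t0 with (u 0%nat); rewrite (delta_int_chain T u n) with (G := G).
  - simpl; ring.
  - intros k _; apply Hcon.
  - reflexivity. }
assert (HconI : forall k, consecutive (ts_Ici T t0) (u k) (u (S k))).
{ intros k; apply consecutive_subset with T; try apply Horb; [| apply Hcon].
  intros s Hs; apply Hs. }
assert (Hstep : forall k, V (S k) <= (1 + Q (u k) * (u (S k) - u k)) * V k).
{ intros k.
  assert (Hm : u k < u (S k)) by apply Hcon.
  assert (Hp : dm h (u k) < u k) by apply Hpre.
  assert (HdmS : dm h (u (S k)) = u k) by apply Hdmdp, Horb.
  (* The derivative of the delay is the ratio of successive graininesses, the [p / m] of
     [lyapunov_step]. *)
  assert (Hdd : delta_derive (ts_Ici T t0) (dm h) (u k)
                = (u k - dm h (u k)) / (u (S k) - u k)).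
  { rewrite (delta_derive_consecutive _ _ _ _ (HconI k)).
    - now rewrite HdmS.
    - apply (delay_derive _ _ _ _ _ _ Hdelay), Horb. }
  assert (Hxk := is_delta_derive_consecutive _ _ _ _ _ (HconI k)
                   (solution_eq _ _ _ _ _ _ _ _ Hx _ (Horb k))).
  assert (Hlo := HQlow _ (Horb k)); assert (Hup := HQup _ (Horb k)).
  unfold beta, mu in Hlo, Hup.
  rewrite (consecutive_sigma _ _ _ (Hcon k)) in Hlo, Hup.
  rewrite Hdd in Hlo, Hxk.
  assert (Hl := lyapunov_step lambda (u k - dm h (u k)) (u (S k) - u k)
    (Q (u k)) (b (u (S k))) (x (u k)) (y k) Hlambda ltac:(lra) ltac:(lra) Hlo Hup).
  unfold V at 1, y at 1 2; rewrite HdmS.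
  eapply Rle_trans; [| exact Hl]; apply Req_le.
  (* In the recursion for [x] the delay term times the gap is exactly [y k], while the new [y (S k)]
     supplies the [b] part of [Q]. *)
  rewrite Hxk; unfold y, Q, Qfun.
  change (dp h (u k)) with (u (S k)); field; lra. }
assert (HVpos : forall k, 0 <= V k).
{ intros k; unfold V; apply Rplus_le_le_0_compat; [apply pow2_ge_0 |].
  apply Rmult_le_pos; [lra | apply pow2_ge_0]. }
assert (HVexp : forall k, V k <= V 0%nat * exp (G k)).
{ induction k as [| k IH]; [simpl; rewrite exp_0; lra |].
  apply Rle_trans with (1 := Hstep k).
  change (G (S k)) with (G k + Q (u k) * (u (S k) - u k)).
  rewrite exp_plus, <- Rmult_assoc, Rmult_comm.
  apply Rle_trans with (V k * exp (Q (u k) * (u (S k) - u k))).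
  - apply Rmult_le_compat_l; [apply HVpos | apply exp_ineq1_le].
  - apply Rmult_le_compat_r; [apply Rlt_le, exp_pos | exact IH]. }
rewrite HV0, HG.
assert (Hc : 0 < 1 + 1 / lambda) by (assert (H := Rdiv_lt_0_compat 1 lambda); lra).
assert (Hcv : 0 <= (1 + 1 / lambda) * V 0%nat)
  by (apply Rmult_le_pos; [lra | apply HVpos]).
(* With absolute values on both sides it suffices to compare squares, which removes the root and the
   factor [1 / 2] in the exponent. *)
rewrite <- (Rabs_pos_eq (_ * exp _))
  by (apply Rmult_le_pos; [apply sqrt_pos | apply Rlt_le, exp_pos]).
apply Rsqr_le_abs_0.
rewrite Rsqr_mult, Rsqr_sqrt by exact Hcv.
replace (Rsqr (exp (1 / 2 * G n))) with (exp (G n))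
  by (unfold Rsqr; rewrite <- exp_plus; f_equal; lra).
rewrite Rsqr_pow2, Rmult_assoc.
apply Rle_trans with ((1 + 1 / lambda) * V n).
- apply lyapunov_lower, Hlambda.
- apply Rmult_le_compat_l; [lra | apply HVexp].
Qed.
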